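(* Let $f \colon \mathbb{Z} \to \mathbb{N}_0 \cup \{\infty\}$ be a function such that the set $f^{-1}(0)$ is finite. Let $\phi \colon \mathbb{N}_0 \to \mathbb{R}$ be any nonnegative function with $\lim_{x\to\infty}\phi(x) = \infty$. Then there exists an asymptotic basis $A$ of the integers such that $r_A(n) = f(n)$ for all integers $n$, and for infinitely many positive integers $x$ we have $A(-x,x) > \sqrt{x}/\phi(x)$.
   Context: $\mathbb{N}_0$ denotes the set of nonnegative integers. For a set $A$ of integers, the representation function is $r_A(n) = \mathrm{card}\{(a,b) : a,b\in A,\ a\le b,\ a+b=n\}$ for $n\in\mathbb{Z}$. A set $A\subseteq\mathbb{Z}$ is an asymptotic basis of the integers if all but finitely many integers can be written as $a+b$ with $a,b\in A$. The counting function is $A(y,x) = \mathrm{card}\{a\in A : y\le a\le x\}$ for real $x,y$. *)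

(* Defs.v *)
From mathcomp Require Import all_boot all_order all_algebra finmap.
From mathcomp Require Import all_classical all_reals all_analysis.
Set Implicit Arguments.
Unset Strict Implicit.
Unset Printing Implicit Defensive.
Import Order.TTheory GRing.Theory Num.Theory.
Import numFieldNormedType.Exports.
Local Open Scope classical_set_scope.
Local Open Scope ring_scope.

(* The elements of N_0 \cup {oo}: [Some k] is the natural number k, [None] is
   infinity. *)
Definition enat := option nat.

Definition ecard (T : choiceType) (S : set T) : enat :=
  if `[< finite_set S >] then Some #|` fset_set S| else None.

Definition repr_fun (A : set int) (n : int) : enat :=
  ecard [set p : int * int | [/\ A p.1, A p.2, p.1 <= p.2 & p.1 + p.2 = n]].

Definition asymptotic_basis (A : set int) : Prop :=
  finite_set [set n : int | ~ exists a b : int, [/\ A a, A b & n = a + b]].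

(* [fset_set] is only meaningful on finite sets; the set below is always finite,
   since it lies in a bounded interval of integers. *)
Definition counting_fun (R : realType) (A : set int) (y x : R) : nat :=
  #|` fset_set [set a : int | A a /\ y <= a%:~R <= x]|.

(* Main.v *)
(* The set A is the union of a chain of finite sets whose representation
   function never exceeds f.  To raise the number of representations of n, adjoin
   b and n - b with b so large that every other new sum is new, is represented
   once, and lies outside the finite set f^{-1}(0).  To make the chain dense,
   adjoin a translate far to the right of (2M+1) S, where M bounds everything
   built so far and S is the Erdos-Turan Sidon set {2pk + (k^2 mod p) : k < p}:
   the dilation keeps the sums a + d (a old, d new) distinct, and since M is fixed
   before p is chosen, the p new elements lie below a constant times p^2, which is
   beaten by phi once p is large. *)
Require Import Defs.
From mathcomp Require Import all_boot all_order all_algebra finmap.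
From mathcomp Require Import all_classical all_reals all_analysis.
From mathcomp Require Import zify ring.
Import Order.TTheory GRing.Theory Num.Theory.
Import numFieldNormedType.Exports.
Local Open Scope classical_set_scope.
Local Open Scope ring_scope.

Set Implicit Arguments.
Unset Strict Implicit.

(** * Representations in finite sets *)

Definition reps (A : {fset int}) (n : int) : {fset int * int} :=
  [fset p in (A `*` A)%fset | ((p.1 <= p.2) && (p.1 + p.2 == n))%R]%fset.

Lemma repsP (A : {fset int}) (n : int) (p : int * int) :
  reflect [/\ p.1 \in A, p.2 \in A, p.1 <= p.2 & p.1 + p.2 = n]
          (p \in reps A n).
Proof.
rewrite !inE /=; apply: (iffP idP).
  by case/andP=> /andP[-> ->] /andP[-> /eqP ->].
by case=> -> -> -> ->; rewrite eqxx.
Qed.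

Lemma reps_sub (A A' : {fset int}) (n : int) :
  (A `<=` A')%fset -> (reps A n `<=` reps A' n)%fset.
Proof.
move=> /fsubsetP sAA'; apply/fsubsetP => p /repsP[p1 p2 le12 eqn].
by apply/repsP; split=> //; apply: sAA'.
Qed.

Definition dominated (f : int -> enat) (A : {fset int}) (n : int) : bool :=
  if f n is Some m then (#|` reps A n| <= m)%N else true.

(** An [n] with [f n] infinite stays deficient forever, so each visit to it adds a
    representation. *)
Definition deficient (f : int -> enat) (A : {fset int}) (n : int) : bool :=
  if f n is Some m then (#|` reps A n| < m)%N else true.

(** Here [q] ranges over old representations too: once a new one [p] exists, it is the only one. The
    count is then 1, which is admissible because [f n] is not 0. *)
Lemma dominated_unique_new (f : int -> enat) (A A' : {fset int}) (n : int) :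
  dominated f A n ->
  (forall p q, p \in reps A' n -> p \notin reps A n -> q \in reps A' n ->
     q = p /\ f n <> Some 0%N) ->
  dominated f A' n.
Proof.
rewrite /dominated; case: (f n) => // m leAm new.
have [sub|/fsubsetPn[p pA' pA]] := boolP (reps A' n `<=` reps A n)%fset.
  exact: leq_trans (fsubset_leq_card sub) leAm.
have [_ m0] := new p p pA' pA pA'.
have sub1 : (reps A' n `<=` [fset p])%fset.
  by apply/fsubsetP => q qA'; rewrite inE; have [-> _] := new p q pA' pA qA'.
apply: leq_trans (fsubset_leq_card sub1) _; rewrite cardfs1 lt0n.
by apply/eqP => m00; apply: m0; rewrite m00.
Qed.

(** * Raising the representation count of one integer *)

Lemma fset_int_bounded (B : {fset int}) :
  exists M : nat, forall a, a \in B -> - M%:Z <= a <= M%:Z.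
Proof.
exists (\max_(a <- B) `|a|%N) => a aB.
have : (`|a| <= \max_(a <- B) `|a|)%N by apply: leq_bigmax_seq.
lia.
Qed.

(** With small meaning of absolute value at most [M], the sums small + small, small + [b], [b] +
    [b], small + [(n - b)] and twice [n - b] fill disjoint ranges, so a sum reveals its large
    summands. Those with a large summand miss [[-M, M]], except [b + (n - b) = n], which is
    excluded. *)
Lemma pair_sums_unique (M b n p1 p2 q1 q2 : int) :
  0 <= M -> b = 10 * M + 10 -> - M <= n <= M ->
  [\/ p1 = b, p1 = n - b | - M <= p1 <= M] ->
  [\/ p2 = b, p2 = n - b | - M <= p2 <= M] ->
  [\/ q1 = b, q1 = n - b | - M <= q1 <= M] ->
  [\/ q2 = b, q2 = n - b | - M <= q2 <= M] ->
  p1 <= p2 -> q1 <= q2 -> q1 + q2 = p1 + p2 -> p1 + p2 <> n ->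
  ~ (- M <= p1 <= M /\ - M <= p2 <= M) ->
  ~ (- M <= p1 + p2 <= M) /\ q1 = p1.
Proof.
move=> M0 bE nM p1E p2E q1E q2E lep leq eqs npn new.
case: p1E => p1E; case: p2E => p2E; try (exfalso; lia).
all: split; first lia.
all: by case: q1E => q1E; case: q2E => q2E; clear new; lia.
Qed.

Lemma add_representation (f : int -> enat) (A : {fset int}) (n : int) :
  finite_set (f @^-1` [set Some 0%N]) ->
  (forall k, dominated f A k) ->
  deficient f A n ->
  exists A' : {fset int}, [/\ (A `<=` A')%fset, forall k, dominated f A' k &
    (#|` reps A n| < #|` reps A' n|)%N].
Proof.
move=> fin0 domA ltn.
(* A single [M] bounds [n], the set [A] and the zeros of [f]. *)
have [M bM] := fset_int_bounded (n |` (A `|` fset_set (f @^-1` [set Some 0%N])))%fset.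
have bA a : a \in A -> - M%:Z <= a <= M%:Z.
  by move=> aA; apply: bM; rewrite !inE aA orbT.
have bn : - M%:Z <= n <= M%:Z by apply: bM; rewrite !inE eqxx.
have b0 k : f k = Some 0%N -> - M%:Z <= k <= M%:Z.
  by move=> fk; apply: bM; rewrite !inE in_fset_set // [X in _ || (_ || X)]mem_set ?orbT.
pose b : int := (10 * M + 10)%:Z.
have bE : b = 10 * M%:Z + 10 by rewrite /b; lia.
clearbody b.
pose A' := (b |` ((n - b) |` A))%fset.
have memA' a : a \in A' -> [\/ a = b, a = n - b | a \in A /\ - M%:Z <= a <= M%:Z].
  rewrite !inE => /orP[/eqP->|/orP[/eqP->|aA]]; [exact: Or31|exact: Or32|].
  by apply: Or33; split=> //; apply: bA.
have sAA' : (A `<=` A')%fset by apply/fsubsetP => a aA; rewrite !inE aA !orbT.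
have bnA : b \notin A by apply/negP => /bA; lia.
have newP : (n - b, b) \notin reps A n by apply/repsP => -[_ /= bA' _ _]; rewrite bA' in bnA.
have newP' : (n - b, b) \in reps A' n.
  by apply/repsP; split=> /=; rewrite ?inE ?eqxx ?orbT //; lia.
have smallA a : a \in A' -> - M%:Z <= a <= M%:Z -> a \in A.
  by case/memA' => [->|->|[]//] small; exfalso; move: bE bn small; clear; lia.
have shape a : a \in A' -> [\/ a = b, a = n - b | - M%:Z <= a <= M%:Z].
  by case/memA' => [->|->|[]]; [exact: Or31|exact: Or32|move=> *; exact: Or33].
(* The target [n] gains only the pair [(n - b, b)], and the strict inequality in [deficient] leaves
   room for it. *)
have sub : (reps A' n `<=` (n - b, b) |` reps A n)%fset.
  apply/fsubsetP => -[p q] /repsP[/= pA qA lepq eqn]; rewrite in_fset1U.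
  have [/andP[pA' qA']|small] := boolP ((p \in A) && (q \in A)).
    by apply/orP; right; apply/repsP.
  apply/orP; left; apply/eqP.
  have nsmall : ~ (- M%:Z <= p <= M%:Z /\ - M%:Z <= q <= M%:Z).
    by case=> sp sq; move: small; rewrite !smallA.
  have pE : p = n - b.
    move: lepq eqn bE bn nsmall (shape _ pA) (shape _ qA); clear.
    by move=> ? ? ? ? ? [] ? [] ?; lia.
  by congr (_, _) => //; move: eqn pE; clear; lia.
exists A'; split=> //; last first.
  apply: leq_trans (fsubset_leq_card (_ : ((n - b, b) |` reps A n) `<=` _)%fset).
    by rewrite cardfsU1 newP.
  by rewrite fsubUset fsub1set newP' reps_sub.
move=> k; have [->|kn] := eqVneq k n.
  move: ltn; rewrite /deficient /dominated; case: (f n) => // m ltm.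
  by apply: leq_trans (fsubset_leq_card sub) _; rewrite cardfsU1 newP.
(* Any other [k] with a new representation lies outside [[-M, M]], hence is not a zero of [f]. *)
apply: dominated_unique_new (domA k) _ => -[p1 p2] [q1 q2].
move=> /repsP[/= p1A p2A lep eqp] /repsP newp /repsP[/= q1A q2A leq eqq].
have nsmall : ~ (- M%:Z <= p1 <= M%:Z /\ - M%:Z <= p2 <= M%:Z).
  by case=> s1 s2; apply: newp; split=> //=; apply: smallA.
have [] := @pair_sums_unique M%:Z b n p1 p2 q1 q2 _ bE bn (shape _ p1A)
  (shape _ p2A) (shape _ q1A) (shape _ q2A) lep leq _ _ nsmall => //.
- by rewrite eqp eqq.
- by rewrite eqp; apply/eqP.
rewrite eqp => nb q1E; split; last by move/b0.
by congr (_, _) => //; move: q1E eqp eqq; clear; lia.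
Qed.

(** * Adjoining a separated Sidon block *)

Definition sidon (D : {fset int}) : Prop := forall a b c d,
  a \in D -> b \in D -> c \in D -> d \in D -> a <= b -> c <= d ->
  a + b = c + d -> a = c.

(** The bound on [t] puts [A + A], [A + D] and [D + D] in disjoint ranges, the last two above [M].
    Equal sums in [A + D] have elements of [D] at distance at most [2M], so separation identifies
    them; in [D + D] the Sidon property does. *)
Lemma add_sidon (f : int -> enat) (A D : {fset int}) (M L : nat) (t : int) :
  (forall a, a \in A -> - M%:Z <= a <= M%:Z) ->
  (forall k, f k = Some 0%N -> - M%:Z <= k <= M%:Z) ->
  (forall k, dominated f A k) ->
  sidon D ->
  (forall d, d \in D -> t <= d <= t + L%:Z) -> L%:Z + 4 * M%:Z < t ->
  (forall d e, d \in D -> e \in D -> `|d - e| <= 2 * M%:Z -> d = e) ->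
  forall k, dominated f (A `|` D)%fset k.
Proof.
move=> bA b0 domA sidonD bD tL sepD k.
apply: dominated_unique_new (domA k) _ => -[p1 p2] [q1 q2].
move=> /repsP[/= p1A p2A lep eqp] /repsP newp /repsP[/= q1A q2A leq eqq].
have newp' : ~ (p1 \in A /\ p2 \in A) by move=> [? ?]; apply: newp.
have mem a : a \in (A `|` D)%fset ->
    (a \in A /\ - M%:Z <= a <= M%:Z) \/ (a \in D /\ t <= a <= t + L%:Z).
  by rewrite inE => /orP[aA|aD]; [left; split=> //; apply: bA|right; split=> //; apply: bD].
have big : ~ (- M%:Z <= k <= M%:Z) /\ p1 = q1.
  case: (mem _ p1A) => [[p1A' bp1]|[p1D bp1]];
  case: (mem _ p2A) => [[p2A' bp2]|[p2D bp2]]; try by case: newp'.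
  - split; first lia.
    case: (mem _ q1A) => [[_ bq1]|[q1D bq1]];
    case: (mem _ q2A) => [[_ bq2]|[q2D bq2]]; try lia.
    have := sepD _ _ p2D q2D; lia.
  - lia.
  - split; first lia.
    case: (mem _ q1A) => [[_ bq1]|[q1D bq1]];
    case: (mem _ q2A) => [[_ bq2]|[q2D bq2]]; try lia.
    by apply: (sidonD p1 p2 q1 q2) => //; rewrite eqp eqq.
case: big => nb eq1; split; first by congr (_, _); lia.
by move=> /b0.
Qed.

(** * The Erdos-Turan Sidon set *)

Definition erdos_turan (p k : nat) : nat := (2 * p * k + (k ^ 2) %% p)%N.

Lemma erdos_turan_sidon (p k1 k2 k3 k4 : nat) : prime p -> (2 < p)%N ->
  (k1 < p)%N -> (k2 < p)%N -> (k3 < p)%N -> (k4 < p)%N ->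
  (erdos_turan p k1 + erdos_turan p k2 = erdos_turan p k3 + erdos_turan p k4)%N ->
  (k1 = k3 /\ k2 = k4) \/ (k1 = k4 /\ k2 = k3).
Proof.
move=> pr p2 l1 l2 l3 l4; rewrite /erdos_turan => eqs.
have p0 : (0 < p)%N by lia.
have m1 := ltn_pmod (k1 ^ 2) p0; have m2 := ltn_pmod (k2 ^ 2) p0.
have m3 := ltn_pmod (k3 ^ 2) p0; have m4 := ltn_pmod (k4 ^ 2) p0.
have d1 := divn_eq (k1 ^ 2) p; have d2 := divn_eq (k2 ^ 2) p.
have d3 := divn_eq (k3 ^ 2) p; have d4 := divn_eq (k4 ^ 2) p.
move: m1 m2 m3 m4 d1 d2 d3 d4 eqs.
move: (k1 ^ 2 %% p)%N (k2 ^ 2 %% p)%N (k3 ^ 2 %% p)%N (k4 ^ 2 %% p)%N => r1 r2 r3 r4.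
move: (k1 ^ 2 %/ p)%N (k2 ^ 2 %/ p)%N (k3 ^ 2 %/ p)%N (k4 ^ 2 %/ p)%N => s1 s2 s3 s4.
move=> m1 m2 m3 m4 d1 d2 d3 d4 eqs.
(* Two residues mod [p] add up to less than [2 * p], so division by [2 * p] recovers the sum of the
   indices without a carry. *)
have eqk : (k1 + k2 = k3 + k4)%N.
  have : (((k1 + k2) * (2 * p) + (r1 + r2)) %/ (2 * p) =
          ((k3 + k4) * (2 * p) + (r3 + r4)) %/ (2 * p))%N by congr (_ %/ _)%N; lia.
  by rewrite !divnMDl ?(divn_small (m := r1 + r2)) ?(divn_small (m := r3 + r4)); lia.
have eqr : (r1 + r2 = r3 + r4)%N.
  have : (2 * p * (k1 + k2) = 2 * p * (k3 + k4))%N by rewrite eqk.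
  lia.
(* Equal sums of indices, and of squares mod [p], make [p] divide this product. As [p] is an odd
   prime and both differences are less than [p] in absolute value, one of them vanishes. *)
have eqZ : 2 * (k1%:Z - k3%:Z) * (k3%:Z - k2%:Z)
    = (s1%:Z + s2%:Z - s3%:Z - s4%:Z) * p%:Z.
  have e1 : k1%:Z ^+ 2 = s1%:Z * p%:Z + r1%:Z by rewrite expr2; nia.
  have e2 : k2%:Z ^+ 2 = s2%:Z * p%:Z + r2%:Z by rewrite expr2; nia.
  have e3 : k3%:Z ^+ 2 = s3%:Z * p%:Z + r3%:Z by rewrite expr2; nia.
  have e4 : k4%:Z ^+ 2 = s4%:Z * p%:Z + r4%:Z by rewrite expr2; nia.
  have e5 : k4%:Z = k1%:Z + k2%:Z - k3%:Z by lia.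
  have e6 : r4%:Z = r1%:Z + r2%:Z - r3%:Z by lia.
  have -> : 2 * (k1%:Z - k3%:Z) * (k3%:Z - k2%:Z)
      = k1%:Z ^+ 2 + k2%:Z ^+ 2 - k3%:Z ^+ 2 - k4%:Z ^+ 2 by rewrite e5; ring.
  by rewrite e1 e2 e3 e4 e6; ring.
have dvdp : (p %| 2 * `|k1%:Z - k3%:Z| * `|k3%:Z - k2%:Z|)%N.
  move: (congr1 absz eqZ); rewrite !abszM /= => ->; exact: dvdn_mull.
have small (a : nat) : (a < p)%N -> (p %| a)%N -> a = 0%N.
  by move=> ap; case: a ap => // a ap /dvdn_leq; lia.
move: dvdp; rewrite !Euclid_dvdM // => /orP[/orP[]|] /small; lia.
Qed.

Lemma erdos_turan_inj (p : nat) : {in [pred k | (k < p)%N] &, injective (erdos_turan p)}.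
Proof.
move=> k l; rewrite !inE /erdos_turan => kp lp eqkl.
have p0 : (0 < p)%N by lia.
have mk := ltn_pmod (k ^ 2) p0; have ml := ltn_pmod (l ^ 2) p0.
have : ((k * (2 * p) + k ^ 2 %% p) %/ (2 * p) =
        (l * (2 * p) + l ^ 2 %% p) %/ (2 * p))%N by congr (_ %/ _)%N; lia.
by rewrite !divnMDl ?(divn_small (m := k ^ 2 %% p)) ?(divn_small (m := l ^ 2 %% p)); lia.
Qed.

(** Dilation and translation preserve the Sidon property, and the factor [2M + 1] forces gaps larger
    than [2M]. *)
Lemma separated_sidon_block (M p : nat) : prime p -> (2 < p)%N ->
  exists (D : {fset int}) (t : int) (L : nat),
    [/\ sidon D, #|` D| = p,
        (forall d, d \in D -> t <= d <= t + L%:Z),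
        (forall d e, d \in D -> e \in D -> `|d - e| <= 2 * M%:Z -> d = e) &
        L%:Z + 4 * M%:Z < t /\ t + L%:Z <= ((12 * M + 5) * p ^ 2)%N%:Z].
Proof.
move=> pr p2; pose c : int := 2 * M%:Z + 1.
pose L := ((2 * M + 1) * (2 * p ^ 2))%N; pose t : int := L%:Z + 4 * M%:Z + 1.
pose g k : int := t + c * (erdos_turan p k)%:Z.
have c0 : c != 0 by rewrite /c; lia.
pose s := [seq g k | k <- iota 0 p].
pose D : {fset int} := [fset x in s]%fset.
have memD d : d \in D -> exists2 k, (k < p)%N & d = g k.
  by rewrite inE => /mapP[k]; rewrite mem_iota => kp ->; exists k.
exists D, t, L; split.
- move=> x y z w /memD[k1 l1 ->] /memD[k2 l2 ->] /memD[k3 l3 ->] /memD[k4 l4 ->].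
  move=> le12 le34 eqs.
  have eqet : (erdos_turan p k1 + erdos_turan p k2 =
               erdos_turan p k3 + erdos_turan p k4)%N.
    suff : (erdos_turan p k1)%:Z + (erdos_turan p k2)%:Z =
           (erdos_turan p k3)%:Z + (erdos_turan p k4)%:Z by lia.
    by apply: (mulfI c0); move: eqs; rewrite /g; lia.
  have [[-> //]|[e14 e23]] := erdos_turan_sidon pr p2 l1 l2 l3 l4 eqet.
  by subst k4 k3; apply/eqP; rewrite eq_le le12 le34.
- rewrite card_fseq undup_id ?size_map ?size_iota // map_inj_in_uniq ?iota_uniq //.
  move=> k l; rewrite !mem_iota /g => kp lp /addrI /(mulfI c0) [].
  exact: erdos_turan_inj.
- move=> d /memD[k kp ->]; rewrite /g /c /L.
  have etp : (erdos_turan p k <= 2 * p ^ 2)%N.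
    rewrite /erdos_turan; have := ltn_pmod (k ^ 2) (prime_gt0 pr).
    move: (k ^ 2 %% p)%N => r rp; nia.
  have : ((2 * M + 1) * erdos_turan p k <= (2 * M + 1) * (2 * p ^ 2))%N.
    by rewrite leq_mul2l etp orbT.
  by lia.
- move=> d e /memD[k kp ->] /memD[l lp ->]; rewrite /g.
  have -> : t + c * (erdos_turan p k)%:Z - (t + c * (erdos_turan p l)%:Z)
     = c * ((erdos_turan p k)%:Z - (erdos_turan p l)%:Z) by ring.
  rewrite normrM => small.
  suff -> : (erdos_turan p k)%:Z = (erdos_turan p l)%:Z by [].
  move: small; rewrite /c.
  move: (erdos_turan p k)%:Z (erdos_turan p l)%:Z => u v small.
  by apply/eqP; apply: contraT => uv; nia.
- split; first by rewrite /t; lia.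
  (* Here [t + L = (8M + 4) p^2 + 4M + 1]; absorbing [4M + 1] into [(4M + 1) p^2] gives the constant
     [12M + 5]. *)
  rewrite /t /L.
  have : (4 * M + 1 <= (4 * M + 1) * p ^ 2)%N by rewrite leq_pmulr // expn_gt0; lia.
  by lia.
Qed.

(** * The counting function and dense blocks *)

Lemma counting_fun_ge (R : realType) (A : set int) (B : {fset int}) (x : nat) :
  [set` B] `<=` A -> (forall b, b \in B -> - x%:Z <= b <= x%:Z) ->
  (#|` B| <= counting_fun A (- x%:R : R) x%:R)%N.
Proof.
move=> sBA bB; rewrite /counting_fun.
set S := [set a : int | _].
have SE a : S a <-> A a /\ - x%:Z <= a <= x%:Z.
  by rewrite /S /= pmulrn -mulrNz !ler_int.
(* Finiteness comes first, since [fset_set] of an infinite set is only a default value. *)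
have finS : finite_set S.
  apply: (sub_finite_set (B := [set` [seq (i : nat)%:Z - x%:Z | i <- iota 0 (2 * x).+1]])).
    move=> a /SE[_ ab]; rewrite /mkset; apply/mapP; exists (absz (a + x%:Z)); last by lia.
    by rewrite mem_iota; lia.
  exact: finite_seq.
apply: fsubset_leq_card; apply/fsubsetP => b bB'.
by rewrite in_fset_set // mem_set //; apply/SE; split; [exact: sBA|exact: bB].
Qed.

(** Density is recorded on a finite stage; counting is monotone, so it passes to the union. *)
Definition dense_at (R : realType) (phi : nat -> R) (A : {fset int}) (x : nat) : Prop :=
  Num.sqrt (x%:R : R) / phi x
    < (#|` [fset a in A | (- x%:Z <= a <= x%:Z)%R]%fset|)%:R.

Lemma add_dense_block (R : realType) (f : int -> enat) (phi : nat -> R)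
    (A : {fset int}) (m : nat) :
  finite_set (f @^-1` [set Some 0%N]) ->
  phi x @[x --> \oo] --> +oo ->
  (forall k, dominated f A k) ->
  exists2 A' : {fset int}, (A `<=` A')%fset /\ (forall k, dominated f A' k) &
    exists2 x, (m < x)%N & dense_at phi A' x.
Proof.
move=> fin0 phi_oo domA.
have [M bM] := fset_int_bounded (A `|` fset_set (f @^-1` [set Some 0%N]))%fset.
have bA a : a \in A -> - M%:Z <= a <= M%:Z.
  by move=> aA; apply: bM; rewrite !inE aA.
have b0 k : f k = Some 0%N -> - M%:Z <= k <= M%:Z.
  by move=> fk; apply: bM; rewrite !inE in_fset_set // [X in _ || X]mem_set ?orbT.
(* The constant depends on [M] alone, so the threshold [N] is fixed before [p]. Taking [p] above
   [m + N + 2] then gives [p > 2] and puts [x >= p] beyond both [m] and [N]. *)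
have [N _ bigN] : \forall x \near \oo, (12 * M + 5)%:R < phi x.
  by move/cvgryPgt: phi_oo; apply.
have [p Np pr] := prime_above (m + N + 2)%N.
have p2 : (2 < p)%N by lia.
have [D [t [L [sidD cardD bD sepD [tL tLp]]]]] := separated_sidon_block M pr p2.
pose C := (12 * M + 5)%N.
exists (A `|` D)%fset.
  split; first exact: fsubsetUl.
  by apply: (add_sidon bA b0 domA sidD bD).
pose x := (C * p ^ 2)%N.
have px : (p <= x)%N by rewrite /x /C; nia.
exists x; first by lia.
have Dx : (D `<=` [fset a in (A `|` D)%fset | (- x%:Z <= a <= x%:Z)%R])%fset.
  apply/fsubsetP => d dD; rewrite !inE dD orbT /=.
  by have := bD d dD; rewrite /x /C; lia.
have phix : C%:R < phi x by apply: bigN; rewrite /=; lia.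
have C0 : (0 : R) < C%:R by rewrite ltr0n /C; lia.
rewrite /dense_at; apply: (@lt_le_trans _ _ p%:R); last first.
  by rewrite ler_nat -{1}cardD; apply: fsubset_leq_card.
rewrite ltr_pdivrMr; last exact: lt_trans phix.
have p0 : (0 : R) < p%:R by rewrite ltr0n; lia.
(* Since [C >= 1], the square root of [x = C p^2] is at most [p C], which is less than
   [p * phi x]. *)
apply: (@le_lt_trans _ _ (p%:R * C%:R)); last by rewrite ltr_pM2l.
rewrite -[leRHS]ger0_norm; last by rewrite mulr_ge0 // ltW.
rewrite -sqrtr_sqr ler_sqrt ?sqr_ge0 // -natrM -natrX ler_nat /x /C; nia.
Qed.

(** * The chain of finite sets *)

Lemma stage (R : realType) (f : int -> enat) (phi : nat -> R)
    (A : {fset int}) (n : int) (m : nat) :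
  finite_set (f @^-1` [set Some 0%N]) ->
  phi x @[x --> \oo] --> +oo ->
  (forall k, dominated f A k) ->
  exists A' : {fset int}, [/\ (A `<=` A')%fset, forall k, dominated f A' k,
    deficient f A n -> (#|` reps A n| < #|` reps A' n|)%N &
    exists2 x, (m < x)%N & dense_at phi A' x].
Proof.
move=> fin0 phi_oo domA.
have [A1 [sAA1 dom1 lt1]] : exists A1 : {fset int}, [/\ (A `<=` A1)%fset,
    forall k, dominated f A1 k &
    deficient f A n -> (#|` reps A n| < #|` reps A1 n|)%N].
  have [dfA|_] := boolP (deficient f A n); last by exists A.
  by have [A1 [? ? ?]] := add_representation fin0 domA dfA; exists A1.
have [A2 [sA12 dom2] dense2] := add_dense_block m fin0 phi_oo dom1.
exists A2; split=> //; first exact: fsubset_trans sA12.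
by move=> /lt1 lt; apply: leq_trans lt _; apply/fsubset_leq_card/reps_sub.
Qed.

(* Every integer is the target of infinitely many stages: k = 2^e (2m+1) has
   target number e. *)
Definition target (k : nat) : int := odflt 0 (choice.unpickle (logn 2 k)).

Lemma target_recurs (n : int) (m : nat) : exists2 k, (m <= k)%N & target k = n.
Proof.
exists (2 ^ choice.pickle n * (2 * m).+1)%N.
  have : (0 < 2 ^ choice.pickle n)%N by rewrite expn_gt0.
  by nia.
have odd0 : logn 2 (2 * m).+1 = 0%N by rewrite lognE dvdn2 /= oddM.
by rewrite /target lognM ?expn_gt0 // pfactorK // odd0 addn0 choice.pickleK.
Qed.

Lemma exists_chain (R : realType) (f : int -> enat) (phi : nat -> R) :
  finite_set (f @^-1` [set Some 0%N]) ->
  phi x @[x --> \oo] --> +oo ->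
  exists A_ : nat -> {fset int}, [/\
    forall i j, (i <= j)%N -> (A_ i `<=` A_ j)%fset,
    forall k n, dominated f (A_ k) n,
    forall k, deficient f (A_ k) (target k) ->
      (#|` reps (A_ k) (target k)| < #|` reps (A_ k.+1) (target k)|)%N &
    forall k, exists2 x, (k < x)%N & dense_at phi (A_ k.+1) x].
Proof.
move=> fin0 phi_oo.
(* Domination is a premise inside the relation, so [next] is total; on undominated sets its value is
   arbitrary. *)
have /choice[next nextP] : forall Ak : {fset int} * nat, exists A' : {fset int},
    (forall n, dominated f Ak.1 n) ->
    [/\ (Ak.1 `<=` A')%fset, forall n, dominated f A' n,
      deficient f Ak.1 (target Ak.2) ->
        (#|` reps Ak.1 (target Ak.2)| < #|` reps A' (target Ak.2)|)%N &
      exists2 x, (Ak.2 < x)%N & dense_at phi A' x].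
  move=> [A k] /=; have [domA|] := pselect (forall n, dominated f A n).
    by have [A' ?] := stage (target k) k fin0 phi_oo domA; exists A'.
  by exists A.
pose A_ := fix A_ k := if k is j.+1 then next (A_ j, j) else fset0.
have dom k n : dominated f (A_ k) n.
  elim: k n => [|k IHk] n; last by have [] := nextP (A_ k, k) IHk.
  rewrite /dominated; case: (f n) => // m.
  suff -> : reps (A_ 0%N) n = fset0 by [].
  by apply/fsetP => p; rewrite inE; apply/repsP => -[]; rewrite inE.
exists A_; split=> //.
- move=> i j /subnK <-; elim: (j - i)%N => [|d IHd] //=.
  by have [sub _ _ _] := nextP (A_ (d + i)%N, (d + i)%N) (dom _); exact: fsubset_trans sub.
- by move=> k; have [] := nextP (A_ k, k) (dom k).
- by move=> k; have [] := nextP (A_ k, k) (dom k).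
Qed.

(** * The union of the chain *)

Lemma chain_reps_reach (f : int -> enat) (A_ : nat -> {fset int}) (n : int) (m : nat) :
  (forall i j, (i <= j)%N -> (A_ i `<=` A_ j)%fset) ->
  (forall k, deficient f (A_ k) (target k) ->
     (#|` reps (A_ k) (target k)| < #|` reps (A_ k.+1) (target k)|)%N) ->
  (if f n is Some l then (m <= l)%N else true) ->
  exists k, (m <= #|` reps (A_ k) n|)%N.
Proof.
move=> mono grow; elim: m => [|m IHm] lem; first by exists 0%N.
have [|k mk] := IHm; first by case: (f n) lem => // l /ltnW.
(* Wait for the next stage aimed at [n]. If the count has not yet passed [m], then [n] is still
   deficient there and the stage raises it. *)
have [k' kk' tk'] := target_recurs n k.
have [big|small] := ltnP m #|` reps (A_ k') n|; first by exists k'.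
have df : deficient f (A_ k') (target k').
  by rewrite tk' /deficient; case: (f n) lem => // l; exact: leq_ltn_trans.
exists k'.+1; have := grow _ df; rewrite tk'; apply: leq_ltn_trans.
by apply: leq_trans mk _; apply/fsubset_leq_card/reps_sub/mono.
Qed.

Lemma repr_fun_chain (f : int -> enat) (A_ : nat -> {fset int}) (n : int) :
  (forall i j, (i <= j)%N -> (A_ i `<=` A_ j)%fset) ->
  (forall k, dominated f (A_ k) n) ->
  (forall k, deficient f (A_ k) (target k) ->
     (#|` reps (A_ k) (target k)| < #|` reps (A_ k.+1) (target k)|)%N) ->
  repr_fun (\bigcup_k [set` A_ k]) n = f n.
Proof.
move=> mono dom grow; rewrite /repr_fun.
set S := [set p : int * int | _].
(* By monotonicity, both entries of a pair already lie in a common stage. *)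
have SP p : S p <-> exists k, p \in reps (A_ k) n.
  split=> [[[i _ pi] [j _ pj] le12 eqn]|[k /repsP[p1 p2 le12 eqn]]].
    exists (maxn i j); apply/repsP; split=> //.
      by apply: (fsubsetP (mono _ _ (leq_maxl i j))).
    by apply: (fsubsetP (mono _ _ (leq_maxr i j))).
  by split=> //; exists k.
have reach m := @chain_reps_reach f A_ n m mono grow.
have subS k : [set` reps (A_ k) n] `<=` S by move=> p pk; apply/SP; exists k.
rewrite /ecard; case fn : (f n) reach => [m|] reach.
  have [//|K mK] := reach m.
  have le_m k : (#|` reps (A_ k) n| <= m)%N by have := dom k; rewrite /dominated fn.
  (* Once [m] representations are present, domination forbids any more at later stages, so [K]
     already has them all. *)
  have SE : S = [set` reps (A_ K) n].
    apply/seteqP; split=> // p /SP[k pk].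
    have sub : (reps (A_ K) n `<=` reps (A_ (maxn k K)) n)%fset.
      exact/reps_sub/mono/leq_maxr.
    have /eqP -> : reps (A_ K) n == reps (A_ (maxn k K)) n.
      by rewrite eqEfcard sub (leq_trans (le_m _)).
    exact: (fsubsetP (reps_sub n (mono _ _ (leq_maxl k K)))).
  rewrite SE asboolT ?set_fsetK; last exact: finite_fset.
  by congr Some; apply/eqP; rewrite eqn_leq le_m.
(* For infinite [f n], a finite [S] would be outgrown by some stage contained in it. *)
rewrite asboolF // => finS.
have [//|k] := reach #|` fset_set S|.+1; rewrite ltnNge => /negP; apply.
apply/fsubset_leq_card/fsubsetP => p pk.
by rewrite in_fset_set // mem_set //; exact: subS pk.
Qed.

Lemma asymptotic_basis_of_repr_fun (A : set int) :
  finite_set (repr_fun A @^-1` [set Some 0%N]) -> asymptotic_basis A.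
Proof.
apply: sub_finite_set => n notin; rewrite /repr_fun /ecard /=.
set S := [set p : int * int | _].
have -> : S = set0.
  by rewrite -subset0 => -[a b] /= [Aa Ab _ abn]; apply: notin; exists a, b.
by rewrite asboolT // fset_set0 cardfs0.
Qed.

Unset Implicit Arguments.

Theorem theorem3p1 (R : realType) (f : int -> enat) (phi : nat -> R)
    (f_fin0 : finite_set (f @^-1` [set Some 0%N]))
    (phi_ge0 : forall x : nat, 0 <= phi x)
    (phi_oo : phi x @[x --> \oo] --> +oo) :
  exists A : set int,
    [/\ asymptotic_basis A,
        forall n : int, repr_fun A n = f n &
        infinite_set [set x : nat | (0 < x)%N /\
          Num.sqrt (x%:R : R) / phi x
            < (counting_fun A (- x%:R : R) (x%:R : R))%:R]].
Proof.
have [A_ [mono dom grow dense]] := exists_chain f_fin0 phi_oo.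
have reprE n : repr_fun (\bigcup_k [set` A_ k]) n = f n.
  exact: repr_fun_chain.
exists (\bigcup_k [set` A_ k]); split=> //.
  by apply: asymptotic_basis_of_repr_fun; rewrite (funext reprE).
set S := [set x : nat | _] => finS.
(* Were [S] finite with maximum [m], the density of stage [m.+1] would give an element of [S] beyond
   [m]. *)
pose m := (\max_(x <- fset_set S) x)%N.
have [x mx dense_x] := dense m.
have Sx : S x.
  split; first exact: leq_ltn_trans mx.
  apply: lt_le_trans dense_x _; rewrite ler_nat.
  apply: counting_fun_ge => [a|a]; rewrite /mkset !inE => /andP[aA ax] //.
  by exists m.+1.
have : (x <= m)%N.
  by apply: leq_bigmax_seq => //; rewrite in_fset_set // mem_set.
by rewrite leqNgt mx.
Qed.
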